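(* Let $\boldsymbol\eta=(\eta_t)_{t\in[0,1]}$ be a standard max-stable process with generator process $\boldsymbol Z=(Z_t)_{t\in[0,1]}$. Let $\mathcal G_d=\{s_0^{(d)},\dots,s_d^{(d)}\}$, $0=s_0^{(d)}<s_1^{(d)}<\dots<s_d^{(d)}=1$, $d\in\mathbb{N}$, be a sequence of grids in $[0,1]$ with diameter $\kappa_d:=\max_{i=1,\dots,d}(s_i^{(d)}-s_{i-1}^{(d)})\to0$ as $d\to\infty$. Let $\hat{\boldsymbol\eta}^{(d)}$ and $\hat{\boldsymbol Z}^{(d)}$ be the discretized versions of $\boldsymbol\eta$ and $\boldsymbol Z$ with grid $\mathcal G_d$. Then the processes $\hat{\boldsymbol\eta}^{(d)}$ and $\hat{\boldsymbol Z}^{(d)}$, $d\in\mathbb{N}$, converge uniformly to $\boldsymbol\eta$ and $\boldsymbol Z$ pathwise, i.e. $$\|\hat{\boldsymbol\eta}^{(d)}-\boldsymbol\eta\|_\infty\to_{d\to\infty}0\quad\text{and}\quad\|\hat{\boldsymbol Z}^{(d)}-\boldsymbol Z\|_\infty\to_{d\to\infty}0$$ with probability one.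
   Context: $\bar C^+[0,1]$ and $\bar C^-[0,1]$ are the nonnegative and nonpositive functions in $C[0,1]$; $\bar E^-[0,1]$ is the set of bounded nonpositive functions $f:[0,1]\to\mathbb{R}$ with only finitely many discontinuities; $\|\cdot\|_\infty$ is the sup-norm. Standard max-stable process (SMSP): a max-stable process $\boldsymbol\eta=(\eta_t)_{t\in[0,1]}$ with sample paths in $\bar C^-[0,1]$ and margins $P(\eta_t\le x)=e^x$, $x\le0$. Equivalently, there is a process $\boldsymbol Z=(Z_t)_{t\in[0,1]}$ with sample paths in $\bar C^+[0,1]$, $Z_t\le c$ a.s. for some constant $c\ge1$, and $E(Z_t)=1$ for all $t$ (a generator process), such that $P(\boldsymbol\eta\le f)=\exp(-E(\sup_{t\in[0,1]}|f(t)|Z_t))$ for all $f\in\bar E^-[0,1]$. Discretized versions: for a grid $0=s_0<s_1<\dots<s_d=1$ put $\|(x,y)\|_{D_{i-1,i}}=E(\max(|x|Z_{s_{i-1}},|y|Z_{s_i}))$ (the $D$-norm pertaining to $(\eta_{s_{i-1}},\eta_{s_i})$), $i=1,\dots,d$. The discretized versions of $\boldsymbol\eta$ and $\boldsymbol Z$ with grid $\{s_0,\dots,s_d\}$ are, for $t\in[s_{i-1},s_i]$, $i=1,\dots,d$, $$\hat\eta_t=\|(s_i-t,t-s_{i-1})\|_{D_{i-1,i}}\max\left(\frac{\eta_{s_{i-1}}}{s_i-t},\frac{\eta_{s_i}}{t-s_{i-1}}\right),\qquad \hat Z_t=\frac{\max\bigl((s_i-t)Z_{s_{i-1}},(t-s_{i-1})Z_{s_i}\bigr)}{\|(s_i-t,t-s_{i-1})\|_{D_{i-1,i}}}.$$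 Convention: $\eta_{s_i}<0$ a.s., and $x/0:=-\infty$ for $x<0$. *)

(* Defs.v *)
From HB Require Import structures.
From mathcomp Require Import all_boot all_order all_algebra.
From mathcomp Require Import all_classical all_reals all_analysis.
From mathcomp Require Import measurable_realfun.

Set Implicit Arguments.
Unset Strict Implicit.
Unset Printing Implicit Defensive.

Import Order.TTheory GRing.Theory Num.Theory.
Import numFieldNormedType.Exports.

Local Open Scope classical_set_scope.
Local Open Scope ring_scope.

(* A process (X_t) with t in [0, 1] is a family X : R -> {RV P >-> R}; every
   notion below depends only on the values X t with t in [0, 1]. *)

Section processes.
Context {R : realType} {d : measure_display} {T : measurableType d}.
Variable P : probability T R.
Implicit Types X Z eta : R -> {RV P >-> R}.

Definition continuous_paths X : Prop :=
  forall w, {within `[0, 1], continuous (fun t => X t w)}.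

(* Traces on C[0, 1] of the sets in <<s cylinders >> are exactly the Borel sets
   of C[0, 1] for the sup-norm. *)
Definition cylinders : set_system (R -> R) :=
  [set C | exists t B,
     [/\ t \in `[0, 1], measurable B & C = [set x : R -> R | B (x t)]]].

Definition path_event (X : R -> T -> R) (A : set (R -> R)) : set T :=
  [set w | A (fun t => X t w)].

(* Taking some of the A i to be the whole space gives the product rule for
   subfamilies. *)
Definition independent_processes n (X : 'I_n -> R -> {RV P >-> R}) : Prop :=
  forall A : 'I_n -> set (R -> R), (forall i, <<s cylinders >> (A i)) ->
    P (\bigcap_(i in [set: 'I_n]) path_event (X i) (A i)) =
    (\prod_(i < n) P (path_event (X i) (A i)))%E.

End processes.

Arguments cylinders {R}.

Section max_stability.
Context {R : realType}.

Definition same_law {d} {T : measurableType d} (P : probability T R)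
    {d'} {T' : measurableType d'} (Q : probability T' R)
    (X : R -> T -> R) (Y : R -> T' -> R) : Prop :=
  forall A, <<s cylinders >> A -> P (path_event X A) = Q (path_event Y A).

Definition iid_copies {d} {T : measurableType d} (P : probability T R)
    (X : R -> {RV P >-> R}) {d'} {T' : measurableType d'}
    (Q : probability T' R) n (Y : 'I_n -> R -> {RV Q >-> R}) : Prop :=
  [/\ forall i, continuous_paths (Y i),
      forall i, same_law Q P (Y i) X &
      independent_processes Y].

(* The number of copies is n.+1, i.e. an arbitrary positive integer. *)
Definition max_stable {d} {T : measurableType d} (P : probability T R)
    (X : R -> {RV P >-> R}) : Prop :=
  continuous_paths X /\
  forall n : nat, exists a b : R -> R,
    [/\ {within `[0, 1], continuous a}, {within `[0, 1], continuous b},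
        forall t, t \in `[0, 1] -> 0 < a t &
        forall d' (T' : measurableType d') (Q : probability T' R)
               (Y : 'I_n.+1 -> R -> {RV Q >-> R}),
          iid_copies X Y ->
          same_law Q P
            (fun t w => (\big[Num.max/Y ord0 t w]_(i < n.+1) Y i t w - b t)
                        / a t)
            X].

End max_stability.

Section smsp.
Context {R : realType}.

Definition standard_max_stable {d} {T : measurableType d}
    (P : probability T R) (eta : R -> {RV P >-> R}) : Prop :=
  [/\ max_stable eta,
      forall t w, t \in `[0, 1] -> eta t w <= 0 &
      forall t x, t \in `[0, 1] -> x <= 0 ->
        P [set w | eta t w <= x] = (expR x)%:E].

Definition generator_process {d} {T : measurableType d}
    (P : probability T R) (Z : R -> {RV P >-> R}) : Prop :=
  [/\ continuous_paths Z,
      forall t w, t \in `[0, 1] -> 0 <= Z t w,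
      exists2 c : R, 1 <= c &
        forall t, t \in `[0, 1] -> {ae P, forall w, Z t w <= c} &
      forall t, t \in `[0, 1] -> ('E_P[Z t] = 1)%E].

(* The set of bounded nonpositive functions on [0, 1] with finitely many
   discontinuities. *)
Definition Eminus : set (R -> R) :=
  [set f : R -> R | [/\ exists M, forall t, t \in `[0, 1] -> `|f t| <= M,
               forall t, t \in `[0, 1] -> f t <= 0 &
               finite_set [set t : R | t \in `[0, 1] /\
                                   ~ (f @ within `[0, 1] (nbhs t) --> f t)]]].

(* The supremum is over a nonempty bounded set: f is bounded, and Z w is
   continuous on [0, 1].  The generator may live on another probability space
   than eta. *)
Definition generator_of {d} {T : measurableType d} (P : probability T R)
    {d'} {T' : measurableType d'} (Q : probability T' R)
    (Z : R -> {RV Q >-> R}) (eta : R -> {RV P >-> R}) : Prop :=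
  generator_process Z /\
  forall f, Eminus f ->
    P [set w | forall t, t \in `[0, 1] -> eta t w <= f t] =
    expeR (- 'E_Q[fun w => sup [set `|f t| * Z t w | t in `[0, 1]]%R])%E.

End smsp.

Section discretization.
Context {R : realType}.

(* Only the values s 0, ..., s n matter. *)
Definition is_grid (n : nat) (s : nat -> R) : Prop :=
  [/\ s 0%N = 0, s n = 1 & forall i, (i < n)%N -> s i < s i.+1].

Definition mesh (n : nat) (s : nat -> R) : R :=
  \big[Num.max/0]_(i < n) (s i.+1 - s i).

(* The first i < n such that t <= s i.+1; if 0 <= t <= 1 then
   s i <= t <= s i.+1. *)
Definition cell (n : nat) (s : nat -> R) (t : R) : nat :=
  find (fun i => t <= s i.+1) (iota 0 n).

Section cellwise.
Context {d : measure_display} {T : measurableType d}.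
Variables (Q : probability T R) (Z : R -> {RV Q >-> R}) (s : nat -> R).

Definition Dnorm (i : nat) (x y : R) : \bar R :=
  'E_Q[fun w => Num.max (`|x| * Z (s i) w)%R (`|y| * Z (s i.+1) w)%R]%E.

(* The inverse of \bar R satisfies 0^-1 = +oo, hence x%:E / 0 = -oo for
   x < 0, as required at the endpoints of a cell. *)
Definition eta_on_cell (e : R -> R) (i : nat) (t : R) : \bar R :=
  (Dnorm i (s i.+1 - t) (t - s i) *
   maxe ((e (s i))%:E / (s i.+1 - t)%:E) ((e (s i.+1))%:E / (t - s i)%:E))%E.

Definition Z_on_cell (z : R -> R) (i : nat) (t : R) : \bar R :=
  ((Num.max ((s i.+1 - t) * z (s i)) ((t - s i) * z (s i.+1)))%:E
   / Dnorm i (s i.+1 - t) (t - s i))%E.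

Definition discretized_eta (n : nat) (e : R -> R) (t : R) : \bar R :=
  eta_on_cell e (cell n s t) t.

Definition discretized_Z (n : nat) (z : R -> R) (t : R) : \bar R :=
  Z_on_cell z (cell n s t) t.

End cellwise.

Definition sup_norm (f : R -> \bar R) : \bar R :=
  ereal_sup [set `|f t|%E | t in `[0, 1]].

End discretization.

(* At a common endpoint of two cells both formulas give the value at the knot,
   so that the choice made in [cell] is irrelevant. *)
Section overlap.
Context {R : realType} {d : measure_display} {T : measurableType d}.
Variables (Q : probability T R) (Z : R -> {RV Q >-> R}).
Variables (n : nat) (s : nat -> R).
Hypotheses (Zgen : generator_process Z) (sgrid : is_grid n s).

Let s_mono i j : (i <= j)%N -> (j <= n)%N -> s i <= s j.
Proof.
elim: j => [|j IH]; first by rewrite leqn0 => /eqP ->.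
rewrite leq_eqVlt => /orP[/eqP -> //|ij] jn.
have [_ _ lts] := sgrid.
by apply: le_trans (IH ij (ltnW jn)) (ltW (lts _ jn)).
Qed.

Let s01 i : (i <= n)%N -> s i \in `[0, 1].
Proof.
move=> ile; have [s0 s1 _] := sgrid.
by rewrite in_itv /= -s0 -s1 !s_mono.
Qed.

Let E_scaled h t : 0 <= h -> t \in `[0, 1] ->
  ('E_Q[fun w => (h * Z t w)%R] = h%:E)%E.
Proof.
move=> h0 t01; have [_ Zge0 _ EZ] := Zgen.
have := EZ t t01; rewrite unlock => EZt.
under eq_integral do rewrite EFinM.
rewrite ge0_integralZl ?EZt ?mule1//.
- by apply/measurable_EFinP.
- by move=> w _; rewrite lee_fin Zge0.
Qed.

Let Dnorm_left i h : (i < n)%N -> 0 <= h -> Dnorm Z s i h 0 = h%:E.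
Proof.
move=> ilt h0; rewrite /Dnorm -(E_scaled h0 (s01 (ltnW ilt))).
congr expectation; apply/funext => w.
have [_ Zge0 _ _] := Zgen.
rewrite normr0 mul0r (ger0_norm h0); apply/max_idPl.
by rewrite mulr_ge0 ?Zge0 ?s01 // ltnW.
Qed.

Let Dnorm_right i h : (i < n)%N -> 0 <= h -> Dnorm Z s i 0 h = h%:E.
Proof.
move=> ilt h0; rewrite /Dnorm -(E_scaled h0 (s01 ilt)).
congr expectation; apply/funext => w.
have [_ Zge0 _ _] := Zgen.
rewrite normr0 mul0r (ger0_norm h0); apply/max_idPr.
by rewrite mulr_ge0 ?Zge0 ?s01.
Qed.

Let cellP i t : (i < n)%N -> s i <= t <= s i.+1 ->
  cell n s t = i \/
  exists2 j, i = j.+1 & t = s j.+1 /\ cell n s t = j.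
Proof.
move=> ilt /andP[sit tsi].
have [s0 s1 lts] := sgrid.
pose p j := t <= s j.+1.
have hasp : has p (iota 0 n).
  by apply/hasP; exists i => //; rewrite mem_iota.
have jlt : (cell n s t < n)%N.
  by rewrite -[X in (_ < X)%N](size_iota 0) -has_find.
have pj : t <= s (cell n s t).+1.
  have := nth_find 0%N hasp.
  by rewrite -/(cell n s t) nth_iota // add0n.
have jle : (cell n s t <= i)%N.
  rewrite leqNgt; apply/negP => ij.
  have := before_find 0%N ij; rewrite nth_iota // add0n.
  by rewrite tsi.
move: jle; rewrite leq_eqVlt => /orP[/eqP ->|ji]; [by left|right].
have := s_mono ji (ltnW ilt) => sji.
have tE : t = s (cell n s t).+1.
  by apply/eqP; rewrite eq_le pj (le_trans sji).
exists (cell n s t) => //.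
apply/eqP; rewrite eqn_leq ji andbT leqNgt; apply/negP => jSi.
have := s_mono jSi (ltnW ilt).
have jSn : ((cell n s t).+1 < n)%N by apply: ltn_trans ilt.
by move/(lt_le_trans (lts _ jSn)); rewrite -tE ltNge sit.
Qed.

Lemma discretized_etaE e i t :
  (forall j, (j <= n)%N -> e (s j) < 0) ->
  (i < n)%N -> s i <= t <= s i.+1 ->
  discretized_eta Z s n e t = eta_on_cell Z s e i t.
Proof.
move=> e0 ilt tP; rewrite /discretized_eta.
have [_ _ lts] := sgrid.
case: (cellP ilt tP) => [->//|[j ij [-> ->]]].
rewrite {}ij in ilt *; have jlt := ltnW ilt.
have h1 : 0 < s j.+1 - s j by rewrite subr_gt0 lts.
have h2 : 0 < s j.+2 - s j.+1 by rewrite subr_gt0 lts.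
have E := e0 _ jlt.
have E1 := e0 _ (ltnW jlt).
have E2 := e0 _ ilt.
rewrite /eta_on_cell !subrr Dnorm_right ?Dnorm_left ?ltW //.
rewrite !inve0 !lt0_muley ?lte_fin // maxNye maxeNy !inver !gt_eqF //.
by rewrite -!EFinM !(mulrCA _ (e _)) !divff ?gt_eqF.
Qed.

Lemma discretized_ZE z i t :
  (forall u, u \in `[0, 1] -> 0 <= z u) ->
  (i < n)%N -> s i <= t <= s i.+1 ->
  discretized_Z Z s n z t = Z_on_cell Z s z i t.
Proof.
move=> z0 ilt tP; rewrite /discretized_Z.
have [_ _ lts] := sgrid.
case: (cellP ilt tP) => [->//|[j ij [-> ->]]].
rewrite {}ij in ilt *; have jlt := ltnW ilt.
have h1 : 0 < s j.+1 - s j by rewrite subr_gt0 lts.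
have h2 : 0 < s j.+2 - s j.+1 by rewrite subr_gt0 lts.
have zj := z0 _ (s01 jlt).
rewrite /Z_on_cell !subrr Dnorm_right ?Dnorm_left ?ltW //.
have p1 := mulr_ge0 (ltW h1) zj.
have p2 := mulr_ge0 (ltW h2) zj.
rewrite !mul0r (max_r p1) (max_l p2).
rewrite !inver !gt_eqF // -!EFinM.
by rewrite ![_ * z _]mulrC -!mulrA !divff ?gt_eqF.
Qed.

End overlap.

(* Main.v *)
Require Import Defs.
From HB Require Import structures.
From mathcomp Require Import all_boot all_order all_algebra.
From mathcomp Require Import all_classical all_reals all_analysis.
From mathcomp Require Import measurable_realfun ring lra.

Import Order.TTheory GRing.Theory Num.Theory.
Import numFieldNormedType.Exports.

Local Open Scope classical_set_scope.
Local Open Scope ring_scope.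

(* With h = s_i - t, k = t - s_(i-1), one has
   max(h, k) <= ||(h, k)||_D <= max(h, k) (1 + delta_n), where delta_n is the
   expectation of the largest increment of Z over a cell of the n-th grid; by
   uniform continuity of the paths and dominated convergence delta_n tends to 0.
   If the D-norm were exactly max(h, k), the discretized value at t would lie
   between the values at the two neighbouring knots, up to which the path has
   small oscillation; the factor 1 + delta_n perturbs this uniformly, since
   paths are bounded. *)

(** * Compactness on a segment *)

Section real_analysis.
Context {R : realType}.
Implicit Types (f z : R -> R) (r : R).

(** The near-covering form of compactness, applied to the filter of [e] tending to 0 from the right,
    merges the local moduli of continuity into one. *)
Lemma within_continuous_unif_continuous f (a b : R) :
  {within `[a, b], continuous f} -> forall r, 0 < r ->
  exists2 e, 0 < e & forall x y, x \in `[a, b] -> y \in `[a, b] ->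
    `|x - y| <= e -> `|f x - f y| <= r.
Proof.
move=> /subspace_continuousP cf r r0.
have /compact_near_coveringP/near_covering_withinP ncov := @segment_compact _ a b.
have key : \forall e \near 0^'+, `[a, b]%classic `<=` (fun x : R =>
    forall y, y \in `[a, b] -> `|x - y| <= e -> `|f x - f y| <= r).
  apply: ncov => x xab; have /= := cf x xab.
  have r2 : 0 < r / 2 by rewrite divr_gt0.
  move=> /cvgrPdist_le /(_ _ r2); rewrite near_withinE near_simpl.
  move=> /nbhs_ballP[e /= e0 He].
  have e2 : 0 < e / 2 by rewrite divr_gt0.
  (* The radius is halved so that [y], within [u < e / 2] of [x'], which is itself within [e / 2] of
     [x], stays in the ball where [He] applies. *)
  exists (ball x (e / 2), [set u | u < e / 2]).
    split; first exact: nbhsx_ballx.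
    by apply: nbhs_right_lt.
  move=> [x' u] [/= xx' ue] x'ab y yab x'y.
  have h1 := He x' _ x'ab.
  have h2 := He y _ yab.
  rewrite (_ : f x' - f y = (f x - f y) - (f x - f x')); last by ring.
  rewrite (le_trans (ler_normB _ _))// [leRHS]splitr lerD//.
  - apply: h2; rewrite /ball/= in xx' *.
    rewrite (_ : x - y = (x - x') + (x' - y)); last by ring.
    rewrite (le_lt_trans (ler_normD _ _))// [ltRHS]splitr ltrD//.
    exact: le_lt_trans ue.
  - by apply: h1; rewrite /ball/= in xx' *; lra.
near (0 : R)^'+ => e.
exists e; first by near: e; exact: nbhs_right_gt.
have ke : `[a, b]%classic `<=` (fun x : R =>
    forall y, y \in `[a, b] -> `|x - y| <= e -> `|f x - f y| <= r).
  by near: e.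
by move=> x y xab; apply: (ke x).
Unshelve. all: by end_near. Qed.

Lemma within_continuous_bounded f (a b : R) :
  {within `[a, b], continuous f} ->
  exists2 M, 0 < M & forall t, t \in `[a, b] -> `|f t| <= M.
Proof.
move=> cf; have /compact_bounded := continuous_compact cf (@segment_compact _ a b).
move=> [M [_ HM]]; exists (`|M| + 1); first by rewrite ltr_wpDl.
move=> t tab; apply: (HM (`|M| + 1)); last by exists t.
by rewrite (le_lt_trans (ler_norm _))// ltrDl.
Qed.

(** * Grids, oscillation over cells, and the sup-norm *)

Lemma mesh_ge n (s : nat -> R) i : (i < n)%N -> s i.+1 - s i <= mesh n s.
Proof. by move=> ilt; exact: (le_bigmax 0 _ (Ordinal ilt)). Qed.

Lemma grid_mono n (s : nat -> R) : is_grid n s ->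
  forall i j, (i <= j)%N -> (j <= n)%N -> s i <= s j.
Proof.
move=> [_ _ lts] i; elim=> [|j IH]; first by rewrite leqn0 => /eqP ->.
rewrite leq_eqVlt => /orP[/eqP -> //|ij] jn.
exact: le_trans (IH ij (ltnW jn)) (ltW (lts _ jn)).
Qed.

Lemma grid01 n (s : nat -> R) : is_grid n s ->
  forall i, (i <= n)%N -> s i \in `[0, 1].
Proof.
move=> sgrid i ile; have [s0 s1 _] := sgrid.
by rewrite in_itv /= -s0 -s1 !(grid_mono _ _ sgrid).
Qed.

Lemma cell_grid n (s : nat -> R) t : (0 < n)%N -> is_grid n s -> t \in `[0, 1] ->
  (cell n s t < n)%N /\ s (cell n s t) <= t <= s (cell n s t).+1.
Proof.
move=> n0 [s0 s1 _]; rewrite in_itv/= => /andP[t0 t1].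
pose p i := t <= s i.+1.
have hasp : has p (iota 0 n).
  apply/hasP; exists n.-1; first by rewrite mem_iota/= add0n ltn_predL.
  by rewrite /p prednK// s1.
have clt : (cell n s t < n)%N.
  by rewrite -[X in (_ < X)%N](size_iota 0) -has_find.
split=> //; apply/andP; split; last first.
  by have := nth_find 0%N hasp; rewrite -/(cell n s t) nth_iota// add0n.
(* At index 0 the left knot is 0; at a later index the preceding cell failed the test of [find], so
   its right knot lies below [t]. *)
case E : (cell n s t) => [|j]; first by rewrite s0.
have jE : (j < cell n s t)%N by rewrite E.
have := before_find 0%N jE.
by rewrite nth_iota ?add0n ?(ltn_trans jE)// => /negbT; rewrite -ltNge => /ltW.
Qed.

Lemma grid_oscillation_cvg0 (s : nat -> nat -> R) z :
  (forall n, (0 < n)%N -> is_grid n (s n)) ->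
  mesh n (s n) @[n --> \oo] --> (0 : R) ->
  {within `[0, 1], continuous z} -> forall r, 0 < r ->
  \forall n \near \oo, forall i x y, (i < n)%N ->
    s n i <= x <= s n i.+1 -> s n i <= y <= s n i.+1 -> `|z x - z y| <= r.
Proof.
move=> sgrid smesh cz r r0.
have [e e0 He] := within_continuous_unif_continuous _ _ _ cz _ r0.
have /cvgr0Pnorm_le/(_ _ e0) := smesh.
(* Index 0 is left out because [is_grid 0] would force 0 = 1. *)
apply: filterS2 (nbhs_infty_gt 0) => n n0 me i x y ilt /andP[xi xi'] /andP[yi yi'].
have si := grid01 _ _ (sgrid n n0) i (ltnW ilt).
have si' := grid01 _ _ (sgrid n n0) i.+1 ilt.
move: si si'; rewrite !in_itv/= => /andP[a0 a1] /andP[b0 b1].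
have mi := mesh_ge _ (s n) _ ilt.
have mn := ler_norm (mesh n (s n)).
apply: He; rewrite ?in_itv/=; [apply/andP; split; lra|apply/andP; split; lra|].
by rewrite ler_norml; apply/andP; split; lra.
Qed.

(** The sup-norm may be infinite for small [n]; the uniform bound with [r = 1] makes it eventually
    finite, after which convergence is tested on its real part. *)
Lemma sup_norm_cvg0 (f : nat -> R -> \bar R) :
  (forall r, 0 < r -> \forall n \near \oo,
    forall t, t \in `[0, 1] -> (`|f n t| <= r%:E)%E) ->
  sup_norm (f n) @[n --> \oo] --> (0 : \bar R)%E.
Proof.
move=> fr.
have sup_ge0 n : (0 <= sup_norm (f n))%E.
  apply: le_trans (abse_ge0 (f n 0)) _; apply: ereal_sup_ubound.
  by exists 0 => //=; rewrite in_itv/= lexx ler01.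
have sup_le r : 0 < r -> \forall n \near \oo, (sup_norm (f n) <= r%:E)%E.
  move=> /fr; apply: filterS => n fn.
  by apply: ge_ereal_sup => _ [t tI <-]; exact: fn.
apply/fine_cvgP; split.
  apply: filterS (sup_le 1 ltr01) => n fn.
  by rewrite fin_numElt (lt_le_trans _ (sup_ge0 n)) ?ltNy0// (le_lt_trans fn)// ltry.
apply/cvgr0Pnorm_le => r r0; apply: filterS (sup_le r r0) => n fn /=.
rewrite ger0_norm ?fine_ge0// -lee_fin fineK// fin_numElt.
by rewrite (lt_le_trans _ (sup_ge0 n)) ?ltNy0// (le_lt_trans fn)// ltry.
Qed.


(** * Deterministic estimates on a single cell *)

Section cell_estimates.
Context {d : measure_display} {T : measurableType d}.
Variables (Q : probability T R) (Z : R -> {RV Q >-> R}) (s : nat -> R) (i : nat).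
Variables (t D delta eps M : R).
Let h := s i.+1 - t.
Let k := t - s i.
Hypotheses (lts : s i < s i.+1) (tP : s i <= t <= s i.+1).
Hypothesis DE : Dnorm Z s i h k = D%:E.
Hypothesis delta0 : 0 <= delta.
Hypothesis DP : Num.max h k <= D <= Num.max h k * (1 + delta).

Let hk : [/\ 0 <= h, 0 <= k & 0 < Num.max h k].
Proof.
move/andP: tP => [t1 t2]; split; rewrite ?subr_ge0// lt_max !subr_gt0.
by case: (ltP t (s i.+1)) => //= ?; apply: lt_le_trans lts _.
Qed.

(** Let [x] be the maximum of the two quotients. Scaled by [Num.max h k], it lies between the
    minimum and the maximum of the knot values. Since [x <= 0], replacing the scale by the larger
    [D] can only lower the product, so [1 + delta] enters the lower bound alone. *)
Lemma eta_on_cell_bounds (e : R -> R) : e (s i) < 0 -> e (s i.+1) < 0 ->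
  exists2 v, eta_on_cell Z s e i t = v%:E &
    Num.min (e (s i)) (e (s i.+1)) * (1 + delta) <= v
      <= Num.max (e (s i)) (e (s i.+1)).
Proof.
move=> ei ei'; have [h0 k0 m0] := hk; have /andP[mD Dm] := DP.
have D0 := lt_le_trans m0 mD.
suff [x [xE x0 xP]] : exists x, [/\
    maxe ((e (s i))%:E / h%:E)%E ((e (s i.+1))%:E / k%:E)%E = x%:E, x <= 0 &
    Num.min (e (s i)) (e (s i.+1)) <= Num.max h k * x
      <= Num.max (e (s i)) (e (s i.+1))].
  exists (D * x); first by rewrite /eta_on_cell -/h -/k DE xE.
  move/andP: xP => [x1 x2]; apply/andP; split; last first.
    by apply: le_trans x2; rewrite ler_wnM2r.
  apply: (@le_trans _ _ (Num.max h k * (1 + delta) * x)); last by rewrite ler_wnM2r.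
  by rewrite mulrAC ler_wpM2r ?addr_ge0.
have hDk : h + k = s i.+1 - s i by rewrite /h /k; ring.
(* At a knot one quotient is -oo and the maximum is the other one, which is finite. *)
move: h0; rewrite le_eqVlt => /predU1P[h0|h0].
  have k1 : 0 < k by move: hDk lts; lra.
  rewrite -h0 inve0 lt0_muley ?lte_fin// maxNye inver gt_eqF//.
  exists (e (s i.+1) / k); split => //.
    by rewrite pmulr_lle0 ?invr_gt0// ltW.
  by rewrite (max_r (ltW k1)) mulrCA divff ?gt_eqF// mulr1 ge_min lexx orbT le_max lexx orbT.
move: k0; rewrite le_eqVlt => /predU1P[k0|k0].
  rewrite -k0 inve0 lt0_muley ?lte_fin// maxeNy inver gt_eqF//.
  exists (e (s i) / h); split => //.
    by rewrite pmulr_lle0 ?invr_gt0// ltW.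
  by rewrite (max_l (ltW h0)) mulrCA divff ?gt_eqF// mulr1 ge_min lexx le_max lexx.
rewrite !inver !gt_eqF// -!EFinM -EFin_max.
exists (Num.max (e (s i) / h) (e (s i.+1) / k)); split => //.
  by rewrite ge_max !pmulr_lle0 ?invr_gt0// !ltW.
rewrite (maxr_pMr _ _ (ltW m0)).
(* Scaling by the larger of [h] and [k] restores the knot value over that denominator ([same]) and
   pushes the other, negative one further down ([scale]). *)
have scale (a p q : R) : a < 0 -> 0 < q -> q <= p -> p * (a / q) <= a.
  move=> a0 q0 qp; rewrite mulrCA.
  have : 1 <= p / q by rewrite ler_pdivlMr// mul1r.
  by move: (p / q) => u; nra.
have same (a p : R) : 0 < p -> p * (a / p) = a.
  by move=> p0; rewrite mulrCA divff ?mulr1// gt_eqF.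
case: (leP h k) => hk'; rewrite same//.
- apply/andP; split; first by rewrite le_max !ge_min lexx !orbT.
  by rewrite ge_max !le_max scale// lexx orbT.
- apply/andP; split; first by rewrite le_max !ge_min lexx.
  by rewrite ge_max !le_max lexx (scale _ _ _ ei' k0 (ltW hk')) orbT.
Qed.

(** Oscillation up to the knots costs [eps]; the factor [1 + delta] acts on [e t - eps], of modulus
    at most [M + eps], and costs [delta * (M + eps)]. *)
Lemma eta_on_cell_dist (e : R -> R) : e (s i) < 0 -> e (s i.+1) < 0 ->
  `|e (s i) - e t| <= eps -> `|e (s i.+1) - e t| <= eps -> `|e t| <= M ->
  (`|eta_on_cell Z s e i t - (e t)%:E| <= (eps + delta * (M + eps))%:E)%E.
Proof.
move=> ei ei'; rewrite !ler_norml => /andP[a1 a2] /andP[b1 b2] /andP[M1 M2].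
have [v -> /andP[v1 v2]] := eta_on_cell_bounds e ei ei'.
rewrite -EFinB /= lee_fin ler_norml.
have dM : 0 <= delta * (M + eps) by rewrite mulr_ge0//; lra.
have hi : v <= e t + eps by rewrite (le_trans v2)// ge_max; apply/andP; split; lra.
have lo : e t - eps <= Num.min (e (s i)) (e (s i.+1)).
  by rewrite le_min; apply/andP; split; lra.
have : (e t - eps) * (1 + delta) <= v.
  by apply: le_trans v1; rewrite ler_wpM2r// addr_ge0.
have : 0 <= delta * (e t + M) by rewrite mulr_ge0//; lra.
by move=> ? ?; apply/andP; split; lra.
Qed.

(** The weighted maximum lies between [Num.max h k] times the smaller and times the larger knot
    value. Here the D-norm divides: [Num.max h k <= D] preserves the upper bound, while the upper
    estimate of [D] costs a factor [1 + delta] in the lower one. *)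
Lemma Z_on_cell_bounds (z : R -> R) : 0 <= z (s i) -> 0 <= z (s i.+1) ->
  exists2 v, Z_on_cell Z s z i t = v%:E &
    Num.min (z (s i)) (z (s i.+1)) <= v * (1 + delta) /\
    0 <= v <= Num.max (z (s i)) (z (s i.+1)).
Proof.
move=> zi zi'; have [h0 k0 m0] := hk; have /andP[mD Dm] := DP.
have D0 := lt_le_trans m0 mD.
have d0 : 0 < 1 + delta := ltr_pwDl ltr01 delta0.
set x := Num.max (h * z (s i)) (k * z (s i.+1)).
exists (x / D); first by rewrite /Z_on_cell DE inver gt_eqF.
have x0 : 0 <= x by rewrite le_max mulr_ge0.
have lo : Num.min (z (s i)) (z (s i.+1)) * Num.max h k <= x.
  rewrite /x le_max; case: (leP h k) => _; rewrite mulrC.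
    by rewrite ler_wpM2l ?orbT// ge_min lexx orbT.
  by rewrite ler_wpM2l// ge_min lexx.
have hi : x <= Num.max (z (s i)) (z (s i.+1)) * Num.max h k.
  rewrite /x ge_max [_ * Num.max h k]mulrC.
  by apply/andP; split; rewrite ler_pM// le_max lexx ?orbT.
split.
  rewrite mulrAC ler_pdivlMr//; apply: le_trans (ler_wpM2l _ Dm) _.
    by rewrite le_min zi zi'.
  by rewrite mulrA ler_wpM2r// ltW.
rewrite divr_ge0 ?(ltW D0)//= ler_pdivrMr//; apply: le_trans hi _.
by rewrite ler_wpM2l// le_max zi.
Qed.

Lemma Z_on_cell_dist (z : R -> R) : 0 <= z (s i) -> 0 <= z (s i.+1) ->
  `|z (s i) - z t| <= eps -> `|z (s i.+1) - z t| <= eps -> `|z t| <= M ->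
  (`|Z_on_cell Z s z i t - (z t)%:E| <= (eps + delta * (M + eps))%:E)%E.
Proof.
move=> zi zi'; rewrite !ler_norml => /andP[a1 a2] /andP[b1 b2] /andP[M1 M2].
have [v -> [v1 /andP[v0 v2]]] := Z_on_cell_bounds z zi zi'.
rewrite -EFinB /= lee_fin ler_norml.
have dM : 0 <= delta * (M + eps) by rewrite mulr_ge0//; lra.
have hi : v <= z t + eps by rewrite (le_trans v2)// ge_max; apply/andP; split; lra.
have lo : z t - eps <= Num.min (z (s i)) (z (s i.+1)).
  by rewrite le_min; apply/andP; split; lra.
(* The upper bound on [v] turns the factor [1 + delta] into an additive error. *)
have : delta * v <= delta * (M + eps) by rewrite ler_wpM2l//; lra.
by move=> ?; apply/andP; split; lra.
Qed.

End cell_estimates.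
End real_analysis.

(** * Bounds on the D-norm from the expected gap of the generator *)

Section generator.
Context {R : realType} {d : measure_display} {T : measurableType d}.
Variables (Q : probability T R) (Z : R -> {RV Q >-> R}).
Hypothesis Zgen : generator_process Z.

(* A finite maximum, hence measurable, unlike the modulus of continuity of Z. *)
Definition grid_gap n (s : nat -> R) (w : T) : R :=
  \big[Num.max/0]_(i < n) `|Z (s i.+1) w - Z (s i) w|.

Lemma grid_gap_ge0 n s w : 0 <= grid_gap n s w.
Proof.
by rewrite /grid_gap; elim/big_rec: _ => // i x _ x0; rewrite le_max x0 orbT.
Qed.

Lemma grid_gap_ge n s i w : (i < n)%N ->
  `|Z (s i.+1) w - Z (s i) w| <= grid_gap n s w.
Proof. by move=> ilt; exact: (le_bigmax 0 _ (Ordinal ilt)). Qed.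

Lemma measurable_grid_gap n s : measurable_fun setT (grid_gap n s).
Proof.
elim: n s => [|n IH] s.
  rewrite (_ : grid_gap 0 s = cst 0)//.
  by apply/funext => w; rewrite /grid_gap big_ord0.
(* Splitting off the first cell leaves the gap over the shifted knots, hence the induction with [s]
   general. *)
rewrite (_ : grid_gap n.+1 s =
    (fun w => `|Z (s 1%N) w - Z (s 0%N) w|) \max grid_gap n (s \o succn)).
  apply: measurable_maxr => //; apply: measurableT_comp => //.
  exact: measurable_funB.
by apply/funext => w; rewrite /grid_gap big_ord_recl.
Qed.

Lemma expectation_scaled (m x : R) (X : T -> R) : 0 <= m ->
  measurable_fun setT X -> (forall w, 0 <= X w) ->
  'E_Q[X]%E = x%:E -> 'E_Q[fun w => (m * X w)%R]%E = (m * x)%:E.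
Proof.
move=> m0 mX X0; rewrite !unlock => EX.
under eq_integral do rewrite EFinM.
rewrite ge0_integralZl ?EX//; first exact/measurable_EFinP.
by move=> w _; rewrite lee_fin X0.
Qed.

(** The maximum dominates each of its two terms, whose expectations are [h] and [k]. Conversely both
    terms are at most [Num.max h k] times [Z (s i)] plus the gap, which has expectation
    [1 + delta]. *)
Lemma Dnorm_bounds n (s : nat -> R) (delta : R) i h k :
  is_grid n s -> 'E_Q[grid_gap n s]%E = delta%:E ->
  (i < n)%N -> 0 <= h -> 0 <= k ->
  exists2 D, Dnorm Z s i h k = D%:E &
    Num.max h k <= D <= Num.max h k * (1 + delta).
Proof.
move=> sgrid Egap ilt h0 k0; have [_ Z0 _ EZ] := Zgen.
have si := grid01 _ _ sgrid i (ltnW ilt).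
have si' := grid01 _ _ sgrid i.+1 ilt.
have m0 : 0 <= Num.max h k by rewrite le_max h0.
have ED : Dnorm Z s i h k =
    'E_Q[fun w => Num.max (h * Z (s i) w)%R (k * Z (s i.+1) w)%R]%E.
  by rewrite /Dnorm !ger0_norm.
have mD : measurable_fun setT
    (fun w => Num.max (h * Z (s i) w) (k * Z (s i.+1) w)).
  by apply: measurable_maxr; exact: measurable_funM.
have D0 w : 0 <= Num.max (h * Z (s i) w) (k * Z (s i.+1) w).
  by rewrite le_max mulr_ge0// Z0.
have lb p t : t \in `[0, 1] -> 0 <= p ->
    (forall w, p * Z t w <= Num.max (h * Z (s i) w) (k * Z (s i.+1) w)) ->
    (p%:E <= Dnorm Z s i h k)%E.
  move=> tI p0 pm; rewrite ED -[p]mulr1.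
  rewrite -(expectation_scaled p 1 (Z t) p0 _ _ (EZ t tI))//; last first.
    by move=> w; exact: Z0.
  apply: expectation_le => //; first exact: measurable_funM.
    by move=> w; rewrite mulr_ge0// Z0.
  exact: aeW.
have lo : ((Num.max h k)%:E <= Dnorm Z s i h k)%E.
  case: (leP h k) => hk.
    by apply: (lb _ (s i.+1)) => // w; rewrite le_max lexx orbT.
  by apply: (lb _ (s i)) => // w; rewrite le_max lexx.
have hi : (Dnorm Z s i h k <= (Num.max h k * (1 + delta))%:E)%E.
  rewrite ED -(expectation_scaled _ _ (fun w => Z (s i) w + grid_gap n s w) m0).
  - apply: expectation_le => //.
    + by apply: measurable_funM => //; apply: measurable_funD => //;
        exact: measurable_grid_gap.
    + by move=> w; rewrite mulr_ge0// addr_ge0 ?grid_gap_ge0// Z0.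
    + apply: aeW => w; rewrite ge_max; apply/andP; split; apply: ler_pM => //.
      * exact: Z0.
      * by rewrite le_max lexx.
      * by rewrite lerDl grid_gap_ge0.
      * exact: Z0.
      * by rewrite le_max lexx orbT.
      * by rewrite -lerBlDl (le_trans (ler_norm _))// grid_gap_ge.
  - by apply: measurable_funD => //; exact: measurable_grid_gap.
  - by move=> w; rewrite addr_ge0 ?grid_gap_ge0// Z0.
  - move: Egap (EZ _ si); rewrite !unlock => Egap EZsi.
    under eq_integral do rewrite EFinD.
    rewrite ge0_integralD//.
    + by rewrite EZsi Egap.
    + by move=> w _; rewrite lee_fin Z0.
    + exact/measurable_EFinP.
    + by move=> w _; rewrite lee_fin grid_gap_ge0.
    + by apply/measurable_EFinP; exact: measurable_grid_gap.
have Dfin : Dnorm Z s i h k \is a fin_num.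
  by rewrite fin_numElt (lt_le_trans _ lo) ?ltNyr// (le_lt_trans hi)// ltry.
exists (fine (Dnorm Z s i h k)); first by rewrite fineK.
by rewrite -!lee_fin fineK// lo hi.
Qed.

(** * Passage to the limit along the grids *)

Variable s : nat -> nat -> R.
Hypothesis sgrid : forall n, (0 < n)%N -> is_grid n (s n).
Hypothesis smesh : mesh n (s n) @[n --> \oo] --> (0 : R).

Lemma expectation_grid_gap_cvg0 :
  'E_Q[grid_gap n (s n)]%E @[n --> \oo] --> (0 : \bar R)%E.
Proof.
have [cZ Z0 [c c1 Zc] _] := Zgen.
(* The bound [c] holds almost surely for each time separately; all grids together have countably
   many knots, so one null set suffices. The dominating function is then the constant [c], as the
   values at the knots lie in [0, c]. *)
have gap_le : {ae Q, forall w, forall n, grid_gap n (s n) w <= c}.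
  have : {ae Q, forall w, forall n i, (0 < n)%N -> (i <= n)%N -> Z (s n i) w <= c}.
    apply: ae_foralln => n; apply: ae_foralln => i.
    case: (ltnP 0 n) => [n0|_]; last by apply: aeW.
    case: (leqP i n) => [ile|_]; last by apply: aeW.
    have := Zc _ (grid01 _ _ (sgrid n n0) i ile).
    by apply: filterS => w Zw _ _.
  apply: filterS => w Zw n; apply: bigmax_le => [|i _].
    exact: le_trans ler01 c1.
  have n0 : (0 < n)%N by case: n i => [[]|].
  have g01 := grid01 _ _ (sgrid n n0).
  have ile := ltnW (ltn_ord i).
  have := Z0 _ w (g01 i ile); have := Z0 _ w (g01 i.+1 (ltn_ord i)).
  have := Zw n i n0 ile; have := Zw n i.+1 n0 (ltn_ord i).
  by move=> ? ? ? ?; rewrite ler_norml; apply/andP; split; lra.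
have mgap n : measurable_fun setT (EFin \o grid_gap n (s n)).
  by apply/measurable_EFinP; exact: measurable_grid_gap.
have gap_cvg w : (grid_gap n (s n) w)%:E @[n --> \oo] --> (0 : \bar R)%E.
  apply/fine_cvgP; split; first exact: nearW.
  apply/cvgr0Pnorm_le => r r0.
  have := grid_oscillation_cvg0 s _ sgrid smesh (cZ w) _ r0.
  apply: filterS2 (nbhs_infty_gt 0) => n n0 osc /=.
  rewrite ger0_norm ?grid_gap_ge0//; apply: bigmax_le => [|i _]; first exact: ltW.
  have [_ _ lts] := sgrid n n0; have /ltW sii := lts i (ltn_ord i).
  by apply: (osc i) => //; rewrite lexx sii.
have gap_dom : {ae Q, forall w, forall n, [set: T] w ->
    (`|(EFin \o grid_gap n (s n)) w| <= (EFin \o cst c) w)%E}.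
  by apply: filterS gap_le => w gw n _; rewrite /= lee_fin ger0_norm ?grid_gap_ge0.
have [_ _] := dominated_convergence measurableT mgap (measurable_cst 0%E)
  (aeW _ (fun w _ => gap_cvg w)) (finite_measure_integrable_cst Q c measurableT)
  gap_dom.
by rewrite integral0 unlock; apply.
Qed.

Lemma Dnorm_uniform_bounds r : 0 < r -> \forall n \near \oo,
  exists2 delta, 0 <= delta <= r & forall i h k,
    (i < n)%N -> 0 <= h -> 0 <= k ->
    exists2 D, Dnorm Z (s n) i h k = D%:E &
      Num.max h k <= D <= Num.max h k * (1 + delta).
Proof.
move=> r0; have /fine_cvgP[Efin /cvgr0Pnorm_le/(_ _ r0) Er] :=
  expectation_grid_gap_cvg0.
apply: filterS3 (nbhs_infty_gt 0) Efin Er => n n0 Efin Er.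
exists (fine 'E_Q[grid_gap n (s n)]%E).
  rewrite fine_ge0 ?(le_trans (ler_norm _) Er)//.
  by apply: expectation_ge0 => w; exact: grid_gap_ge0.
by move=> i h k; apply: Dnorm_bounds (sgrid n n0) _; rewrite fineK.
Qed.

(** Supplies what the cell estimates assume, for an arbitrary continuous path: since [delta] is
    deterministic, the D-norms of [Z] can be combined with paths of [eta] on another probability
    space. *)
Lemma discretized_dist (z : R -> R) r : {within `[0, 1], continuous z} -> 0 < r ->
  \forall n \near \oo, forall t, t \in `[0, 1] ->
  let i := cell n (s n) t in
  exists D delta eps M : R, [/\ (i < n)%N, s n i < s n i.+1, s n i <= t <= s n i.+1,
    Dnorm Z (s n) i (s n i.+1 - t) (t - s n i) = D%:E &
    [/\ 0 <= delta, eps + delta * (M + eps) <= r,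
    Num.max (s n i.+1 - t) (t - s n i) <= D
      <= Num.max (s n i.+1 - t) (t - s n i) * (1 + delta) &
    [/\ `|z (s n i) - z t| <= eps, `|z (s n i.+1) - z t| <= eps & `|z t| <= M]]].
Proof.
move=> cz r0; have [M M0 zM] := within_continuous_bounded _ _ _ cz.
have r2 : 0 < r / 2 by rewrite divr_gt0.
have Mr : 0 < M + r / 2 by rewrite addr_gt0.
have osc := grid_oscillation_cvg0 s z sgrid smesh cz _ r2.
(* With [eps = r / 2], the bound [delta <= (r / 2) / (M + r / 2)] makes the total error at most
   [r]. *)
have Db := Dnorm_uniform_bounds _ (divr_gt0 r2 Mr).
apply: filterS3 (nbhs_infty_gt 0) osc Db => n n0 osc [delta /andP[d0 dr] Db] t tI.
set i := cell n (s n) t; have [ilt tP] := cell_grid _ _ _ n0 (sgrid n n0) tI.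
have [_ _ lts] := sgrid n n0; have sii := lts i ilt.
have [D DE DP] : exists2 D, Dnorm Z (s n) i (s n i.+1 - t) (t - s n i) = D%:E &
    Num.max (s n i.+1 - t) (t - s n i) <= D
      <= Num.max (s n i.+1 - t) (t - s n i) * (1 + delta).
  by have [t1 t2] := andP tP; apply: Db; rewrite ?subr_ge0.
exists D, delta, (r / 2), M; split => //; split => //.
  by rewrite [leRHS]splitr lerD2l -ler_pdivlMr.
split; last exact: zM.
  by apply: (osc i) => //; rewrite lexx ltW.
by apply: (osc i) => //; rewrite lexx ltW.
Qed.

End generator.

(** * Almost sure negativity of the margins, and conclusion *)

Lemma standard_max_stable_lt0 (R : realType) (d : measure_display)
    (T : measurableType d) (P : probability T R) (eta : R -> {RV P >-> R}) t :
  standard_max_stable eta -> t \in `[0, 1] -> {ae P, forall w, eta t w < 0}.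
Proof.
move=> [_ _ eta_cdf] tI.
have mle x : measurable [set w | eta t w <= x].
  rewrite -[X in measurable X]setTI.
  by apply: measurable_fun_le => //; exact: measurable_cst.
have mge : measurable [set w | 0 <= eta t w].
  rewrite -[X in measurable X]setTI.
  by apply: measurable_fun_le => //; exact: measurable_cst.
exists [set w | 0 <= eta t w]; split => //; last first.
  by move=> w /=; rewrite leNgt => /negP.
(* For each [e > 0] the event lies in the complement of [eta t w <= - e], of probability
   [1 - expR (- e) <= e]. *)
apply/eqP; rewrite eq_le measure_ge0 andbT; apply/lee_addgt0Pr => e e0.
rewrite add0e (@le_trans _ _ (P (~` [set w | eta t w <= - e])))//.
  apply: le_measure; rewrite ?inE//; first exact: measurableC.
  by move=> w /= w0; apply/negP; rewrite -ltNge (lt_le_trans _ w0)// oppr_lt0.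
rewrite probability_setC// eta_cdf// ?oppr_le0 ?(ltW e0)// -EFinB lee_fin.
by rewrite lerBlDr -lerBlDl; have := expR_ge1Dx (- e).
Qed.

Theorem theorem3p5 (R : realType)
    (d1 : measure_display) (T1 : measurableType d1) (P : probability T1 R)
    (d2 : measure_display) (T2 : measurableType d2) (Q : probability T2 R)
    (eta : R -> {RV P >-> R}) (Z : R -> {RV Q >-> R}) (s : nat -> nat -> R) :
  standard_max_stable eta ->
  generator_of Z eta ->
  (forall n, (0 < n)%N -> is_grid n (s n)) ->
  mesh n (s n) @[n --> \oo] --> (0 : R) ->
  {ae P, forall w,
    sup_norm (fun t =>
      discretized_eta Z (s n) n (fun u => eta u w) t - (eta t w)%:E)%E
      @[n --> \oo] --> (0 : \bar R)%E}
  /\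
  {ae Q, forall w,
    sup_norm (fun t =>
      discretized_Z Z (s n) n (fun u => Z u w) t - (Z t w)%:E)%E
      @[n --> \oo] --> (0 : \bar R)%E}.
Proof.
move=> smsp [Zgen _] sgrid smesh; split.
  (* Countability of the knots again gives a single null set, off which the path is negative at
     every knot of every grid. *)
  have eta0 : {ae P, forall w, forall n i, (0 < n)%N -> (i <= n)%N ->
      eta (s n i) w < 0}.
    apply: ae_foralln => n; apply: ae_foralln => i.
    case: (ltnP 0 n) => [n0|_]; last by apply: aeW.
    case: (leqP i n) => [ile|_]; last by apply: aeW.
    have := standard_max_stable_lt0 _ _ _ _ _ _ smsp (grid01 _ _ (sgrid n n0) i ile).
    by apply: filterS => w ew _ _.
  have [[ceta _] _ _] := smsp.
  apply: filterS eta0 => w ew; apply: sup_norm_cvg0 => r r0.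
  have := discretized_dist _ _ Zgen _ sgrid smesh _ _ (ceta w) r0.
  apply: filterS2 (nbhs_infty_gt 0) => n n0 dist t tI.
  have [D [delta [eps [M [ilt sii tP DE [d0 le_r DP [e1 e2 eM]]]]]]] := dist t tI.
  apply: le_trans (_ : ((eps + delta * (M + eps))%:E <= _)%E); last by rewrite lee_fin.
  apply: (eta_on_cell_dist _ _ _ _ _ _ _ _ _ sii tP DE d0 DP (fun u => eta u w)) => //.
    exact: ew (ltnW ilt).
  exact: ew ilt.
(* Every path of [Z] is continuous and nonnegative, so convergence holds at every [w]. *)
apply: aeW => w; have [cZ Z0 _ _] := Zgen.
apply: sup_norm_cvg0 => r r0.
have := discretized_dist _ _ Zgen _ sgrid smesh _ _ (cZ w) r0.
apply: filterS2 (nbhs_infty_gt 0) => n n0 dist t tI.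
have [D [delta [eps [M [ilt sii tP DE [d0 le_r DP [e1 e2 eM]]]]]]] := dist t tI.
apply: le_trans (_ : ((eps + delta * (M + eps))%:E <= _)%E); last by rewrite lee_fin.
have g01 := grid01 _ _ (sgrid n n0).
apply: (Z_on_cell_dist _ _ _ _ _ _ _ _ _ sii tP DE d0 DP (fun u => Z u w)) => //.
  exact: Z0 (g01 _ (ltnW ilt)).
exact: Z0 (g01 _ ilt).
Qed.
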